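(* Let $G$ be a finite, simple, connected regular graph with girth $g$ and with $d+1$ distinct adjacency eigenvalues. If either (i) $g\ge 2d-1$, or (ii) $g\ge 2d-2$ and $G$ is bipartite, then $G$ is distance-regular.
   Context: The girth of a graph is the length of a shortest cycle (infinite if there is none). For vertices $u,v$ at distance $i$, let $c_i(u,v),a_i(u,v),b_i(u,v)$ be the number of neighbours of $v$ at distance $i-1$, $i$, $i+1$ from $u$, respectively. A connected graph of diameter $D$ is distance-regular if for each $i=0,\ldots,D$ these three numbers do not depend on the choice of $u,v$ at distance $i$. *)

(* Defs.v *)
From HB Require Import structures.
From mathcomp Require Import all_boot all_order all_algebra.

Set Implicit Arguments.
Unset Strict Implicit.
Unset Printing Implicit Defensive.

Import GRing.Theory.

(* A finite simple graph is a symmetric irreflexive relation e on a finType T. *)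

Section Graph.
Variables (T : finType) (e : rel T).

Definition simple_graph : Prop := symmetric e /\ irreflexive e.

Definition connected_graph : Prop := 0 < #|T| /\ forall u v : T, connect e u v.

Definition regular_graph : Prop :=
  exists k : nat, forall v : T, #|[set w | e v w]| = k.

Definition bipartite : Prop :=
  exists side : T -> bool, forall u v : T, e u v -> side u != side v.

(* The bound 3 rules out the closed walks u-v-u, which are ucycles for a
   symmetric relation. *)
Definition graph_cycle (c : seq T) : Prop := ucycle e c /\ 3 <= size c.

(* None stands for infinite girth. *)
Definition is_girth (g : option nat) : Prop :=
  match g with
  | Some k => (exists2 c, graph_cycle c & size c = k)
              /\ (forall c, graph_cycle c -> k <= size c)
  | None => forall c, ~ graph_cycle c
  end.

Definition walk (n : nat) (u v : T) : bool :=
  [exists p : n.-tuple T, path e u p && (last u p == v)].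

(* The least length of a walk from u to v.  A shortest walk visits no vertex
   twice, so searching the lengths below #|T| is enough; the junk value is #|T|
   when v is not reachable from u. *)
Definition dist (u v : T) : nat := find (fun n => walk n u v) (iota 0 #|T|).

Lemma distP (u v : T) : connect e u v ->
  walk (dist u v) u v /\ forall n, walk n u v -> dist u v <= n.
Proof.
case/connectP=> p0 /shortenP[p ep up _] ->.
have ltp : size p < #|T| by have /card_uniqP /= <- := up; apply: max_card.
have wp : walk (size p) u (last u p).
  by apply/existsP; exists (in_tuple p); rewrite /= ep eqxx.
have hw : has (fun n => walk n u (last u p)) (iota 0 #|T|).
  by apply/hasP; exists (size p); rewrite // mem_iota.
have ltd : dist u (last u p) < #|T| by move: hw; rewrite has_find size_iota.
split=> [|n wn]; first by have /= := nth_find 0 hw; rewrite nth_iota.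
rewrite leqNgt; apply/negP=> ltn.
have /= := before_find 0 ltn.
by rewrite nth_iota ?(ltn_trans ltn) // add0n wn.
Qed.

Definition diameter : nat := \max_(u : T) \max_(v : T) dist u v.

(* The successor is on the side of w, so c_0 = 0 with no truncated i - 1. *)
Definition c_num (i : nat) (u v : T) : nat :=
  #|[set w | e v w & (dist u w).+1 == i]|.
Definition a_num (i : nat) (u v : T) : nat :=
  #|[set w | e v w & dist u w == i]|.
Definition b_num (i : nat) (u v : T) : nat :=
  #|[set w | e v w & dist u w == i.+1]|.

Definition distance_regular : Prop :=
  connected_graph /\
  forall i : nat, i <= diameter ->
  exists c a b : nat, forall u v : T, dist u v = i ->
    [/\ c_num i u v = c, a_num i u v = a & b_num i u v = b].

Definition adjacency (R : nzRingType) : 'M[R]_#|T| :=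
  (\matrix_(i, j) (e (enum_val i) (enum_val j))%:R)%R.

End Graph.

Definition girth_ge (g : option nat) (k : nat) : Prop :=
  match g with Some m => k <= m | None => True end.

Definition num_eigenvalues (F : fieldType) (n : nat) (A : 'M[F]_n) (m : nat)
  : Prop :=
  exists s : seq F, [/\ uniq s, size s = m & s =i eigenvalue A].

(* Main.v *)
Require Import Defs.
From mathcomp Require Import all_boot all_order all_algebra.
From mathcomp Require Import complex zify.

(* Let k be the degree, A the adjacency matrix and D i the distance-i matrix.
   It suffices that each D i * A is distance-invariant, i.e. that its (u, v) entry
   depends only on dist u v.  Small cycles being excluded, D i * A is a combination
   of D (i+1) and D (i-1) for i+1 < m, where m = d in case (i) and m = d-1 in
   case (ii); so A^j is distance-invariant for j < m.  By the spectral theorem the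
   product of the A - x over the eigenvalues x is 0.  Omitting x = k leaves a matrix
   whose rows and columns are k-eigenvectors of A, which are constant since the
   graph is connected; omitting k and -k in the bipartite case leaves a combination
   of two matrices depending only on the parity of the distance.  So A^m is
   distance-invariant too, which settles D i * A for i < m.  The diameter is at most
   d, hence the remaining D i are obtained by subtracting the lower ones from the
   all-ones matrix, or from the matrix of the pairs at distance of the parity of i. *)

Set Implicit Arguments.
Unset Strict Implicit.
Unset Printing Implicit Defensive.

(** * Walks, distances and geodesics *)

Section Distance.
Variables (T : finType) (e : rel T).
Hypothesis sym_e : symmetric e.
Hypothesis conn_e : forall u v : T, connect e u v.

Lemma walkP n u v :
  reflect (exists p, [/\ path e u p, last u p = v & size p = n]) (walk e n u v).
Proof.
apply: (iffP existsP) => [[p /andP[ep /eqP lp]]|[p [ep lp sp]]].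
  by exists p; rewrite size_tuple.
by move/eqP: sp => sp; exists (Tuple sp); rewrite /= ep lp eqxx.
Qed.

Lemma path_reverse (r : rel T) u p : symmetric r -> path r u p ->
  exists q, [/\ path r (last u p) q, last (last u p) q = u & size q = size p].
Proof.
move=> sr rp; exists (rev (belast u p)); split; last by rewrite size_rev size_belast.
  by rewrite rev_path (eq_path (e' := r)) // => x y; rewrite sr.
by case: p {rp} => //= x p; rewrite rev_cons last_rcons.
Qed.

Lemma dist_le_path u p : path e u p -> dist e u (last u p) <= size p.
Proof.
by move=> ep; have [_] := distP (conn_e u (last u p)); apply; apply/walkP; exists p.
Qed.

Lemma dist_path u v :
  exists p, [/\ path e u p, last u p = v & size p = dist e u v].
Proof. by apply/walkP; have [] := distP (conn_e u v). Qed.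

Lemma distxx u : dist e u u = 0.
Proof. by apply/eqP; rewrite -leqn0 (@dist_le_path u [::]). Qed.

Lemma dist_eq0 u v : (dist e u v == 0) = (u == v).
Proof.
apply/eqP/eqP => [|->]; last exact: distxx.
by have [[|x p] [_ <- <-]] := dist_path u v.
Qed.

Lemma distC u v : dist e u v = dist e v u.
Proof.
suff H x y : dist e y x <= dist e x y by apply/eqP; rewrite eqn_leq !H.
have [p [ep <- <-]] := dist_path x y.
have [q [eq lq <-]] := path_reverse sym_e ep.
by rewrite -{2}lq dist_le_path.
Qed.

Lemma dist_edge u v w : e v w -> dist e u w <= (dist e u v).+1.
Proof.
move=> evw; have [p [ep lp <-]] := dist_path u v.
have := @dist_le_path u (rcons p w); rewrite rcons_path ep lp evw last_rcons.
by rewrite size_rcons; apply.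
Qed.

Lemma dist_pred u v i : dist e u v = i.+1 -> exists2 w, e w v & dist e u w = i.
Proof.
move=> di; have [p [ep lp sp]] := dist_path u v.
case/lastP: p ep lp sp => [|p v'] ep lp sp; first by rewrite di in sp.
move: ep lp sp; rewrite rcons_path last_rcons size_rcons di.
move=> /andP[ep ev] ev' [sp]; rewrite ev' in ev.
exists (last u p) => //; apply/eqP; rewrite eqn_leq -{1}sp dist_le_path //=.
by rewrite -ltnS -di dist_edge.
Qed.

(** A geodesic from [u] uses only edges along which the distance from [u] grows, so it suffices that
    [r] keeps those. This is applied with an edge deleted. *)
Lemma dist_geodesic (r : rel T) i u :
    (forall y x, e y x -> dist e u x = (dist e u y).+1 -> dist e u x <= i ->
      r y x) ->
  forall x, dist e u x <= i ->
  exists p, [/\ path r u p, last u p = x & size p = dist e u x].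
Proof.
move=> Hr x; move Dj: (dist e u x) => j; elim: j x Dj => [|j IH] x Dj lji.
  by exists [::]; split=> //; apply/eqP; rewrite -dist_eq0 Dj.
have [y eyx Dy] := dist_pred Dj; have [p [rp lp sp]] := IH y Dy (ltnW lji).
exists (rcons p x); rewrite rcons_path rp lp last_rcons size_rcons sp.
by split=> //; rewrite Hr // ?Dj ?Dy.
Qed.

End Distance.

(** * Short cycles and neighbour counts below the girth *)

Section Cycles.
Variables (T : finType) (e : rel T).
Hypothesis sym_e : symmetric e.
Hypothesis irr_e : irreflexive e.

Definition delete_edge (x y : T) : rel T := fun a b =>
  e a b && ~~ [|| (a == x) && (b == y) | (a == y) && (b == x)].

Lemma delete_edge_sym x y : symmetric (delete_edge x y).
Proof.
move=> a b; rewrite /delete_edge sym_e; congr (_ && ~~ _).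
by rewrite orbC andbC (andbC (b == y)).
Qed.

(** Without the edge, a simple path from [x] to [y] has at least two edges, so closing it with the
    edge gives a genuine cycle. *)
Lemma delete_edge_cycle x y p : e x y -> path (delete_edge x y) x p ->
  last x p = y -> exists2 c, graph_cycle e c & size c <= (size p).+1.
Proof.
move=> exy /shortenP[q rq uq sqp] lq.
have sub : subrel (delete_edge x y) e by move=> a b /andP[].
exists (x :: q); last by rewrite ltnS uniq_leq_size //; case/andP: uq.
split; first by rewrite /ucycle /= rcons_path (sub_path sub) //= lq sym_e exy.
case: q rq lq {uq sqp} => [_ /= xy|z [|//]]; first by rewrite xy irr_e in exy.
by rewrite /= andbT /delete_edge => /andP[_ zy] ly; rewrite ly !eqxx in zy.
Qed.

Hypothesis conn_e : forall u v : T, connect e u v.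

(** Geodesics to [w1] and [w2] stay within distance [i] of [u], so they avoid [v]. Joined at [u] and
    extended from [w2] to [v], they form a walk of length [2i+1] from [w1] to [v] that avoids the
    edge between these two. *)
Lemma two_predecessors_cycle u v w1 w2 i :
    e v w1 -> e v w2 -> w1 != w2 -> dist e u v = i.+1 ->
    dist e u w1 = i -> dist e u w2 = i ->
  exists2 c, graph_cycle e c & size c <= i.+1.*2.
Proof.
move=> e1 e2 w12 dv d1 d2; set r := delete_edge w1 v.
have Hr y x : e y x -> dist e u x = (dist e u y).+1 -> dist e u x <= i -> r y x.
  move=> eyx dx lx; rewrite /r /delete_edge eyx /=; apply/norP; split.
    by apply/nandP; right; apply/eqP=> xv; rewrite xv dv ltnn in lx.
  by apply/nandP; left; apply/eqP=> yv; rewrite dx yv dv ltnNge leqnSn in lx.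
have [p1 [rp1 lp1 sp1]] := dist_geodesic conn_e Hr (eq_leq d1).
have [p2 [rp2 lp2 sp2]] := dist_geodesic conn_e Hr (eq_leq d2).
have [q []] := path_reverse (@delete_edge_sym w1 v) rp1.
rewrite lp1 => rq lq sq.
have rw : r w2 v.
  rewrite /r /delete_edge sym_e e2 eqxx andbT eq_sym (negPf w12) /=.
  by apply/nandP; left; apply/eqP=> wv; rewrite -wv irr_e in e2.
have [|||c cc sc] := @delete_edge_cycle w1 v (q ++ rcons p2 v).
- by rewrite sym_e.
- by rewrite cat_path rq lq rcons_path rp2 lp2.
- by rewrite last_cat last_rcons.
exists c => //; apply: leq_trans sc _.
by rewrite size_cat size_rcons sq sp1 sp2 d1 d2 addnS addnn doubleS.
Qed.

(** An edge between vertices at the same distance from [u] lies on no geodesic from [u], so it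
    closes the geodesics to its ends into a walk of length [2i+1]. *)
Lemma level_edge_cycle u v w i :
    e v w -> dist e u v = i -> dist e u w = i ->
  exists2 c, graph_cycle e c & size c <= i.*2.+1.
Proof.
move=> evw dv dw; set r := delete_edge v w.
have Hr y x : e y x -> dist e u x = (dist e u y).+1 -> dist e u x <= i -> r y x.
  move=> eyx dx lx; rewrite /r /delete_edge eyx /=.
  by apply/norP; split; apply/negP=> /andP[/eqP ? /eqP ?]; subst;
    move/eqP: dx; rewrite ?dw ltn_eqF.
have [p1 [rp1 lp1 sp1]] := dist_geodesic conn_e Hr (eq_leq dv).
have [p2 [rp2 lp2 sp2]] := dist_geodesic conn_e Hr (eq_leq dw).
have [q []] := path_reverse (@delete_edge_sym v w) rp1.
rewrite lp1 => rq lq sq.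
have [|||c cc sc] := @delete_edge_cycle v w (q ++ p2).
- by [].
- by rewrite cat_path rq lq.
- by rewrite last_cat lq.
by exists c => //; apply: leq_trans sc _; rewrite size_cat sq sp1 sp2 dv dw addnn.
Qed.

Variable k : nat.
Hypothesis reg_e : forall v : T, #|[set w | e v w]| = k.

(* Stated with [a_num i u v] for [u] and [v] at any distance: it is then the
   entry of the product of the distance-i matrix and the adjacency matrix. *)
Lemma a_num_large_girth i u v :
    (forall c, graph_cycle e c -> i.+1.*2 < size c) ->
  a_num e i u v = (dist e u v == i.+1) +
                  ((dist e u v).+1 == i) * (k - (0 < dist e u v)).
Proof.
move=> girth.
have c1 j x : j <= i -> dist e u x = j.+1 -> a_num e j u x = 1.
  move=> lji dx; have [w ewx dw] := dist_pred conn_e dx.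
  apply/eqP/cards1P; exists w; apply/setP=> w'; rewrite !inE.
  apply/andP/eqP=> [[exw' /eqP dw']|->]; last by rewrite sym_e ewx dw.
  apply/eqP/negPn/negP=> ww'.
  rewrite sym_e in ewx.
  have [c cc] := two_predecessors_cycle exw' ewx ww' dx dw' dw.
  by rewrite leqNgt (leq_ltn_trans _ (girth c cc)) // leq_double.
have a0 j x : j <= i -> dist e u x = j -> a_num e j u x = 0.
  move=> lji dx; apply/eqP; rewrite cards_eq0; apply/eqP/setP=> w; rewrite !inE.
  apply/negP=> /andP[exw /eqP dw].
  have [c cc] := level_edge_cycle exw dx dw.
  rewrite leqNgt (leq_ltn_trans _ (girth c cc)) // doubleS ltnS.
  by rewrite leqW // leq_double.
have [d1|nd1] := eqVneq (dist e u v) i.+1; first by rewrite d1 c1 // gtn_eqF.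
have [d2|nd2] /= := eqVneq (dist e u v).+1 i; last first.
  have [d3|nd3] := eqVneq (dist e u v) i; first exact: a0.
  apply/eqP; rewrite cards_eq0; apply/eqP/setP=> w; rewrite !inE.
  apply/negP=> /andP[evw /eqP dw].
  have := dist_edge conn_e u evw; rewrite sym_e in evw.
  have := dist_edge conn_e u evw; rewrite dw leq_eqVlt (negPf nd1) /= ltnS.
  rewrite leq_eqVlt (negPf nd3) /= => l1.
  by rewrite leq_eqVlt eq_sym (negPf nd2) ltnNge l1.
(* Now [i] is one above the distance, and the count is the degree minus the number of neighbours
   nearer to [u]: none if [u = v], exactly one otherwise. *)
rewrite add0n mul1n -(reg_e v).
have <- : c_num e (dist e u v) u v = (0 < dist e u v).
  case Dj: (dist e u v) => [|j] /=; first by apply: eq_card0 => w; rewrite !inE andbF.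
  by apply: (c1 j v) => //; rewrite -d2 Dj; lia.
rewrite -(cardsID [set w | dist e u w == i] [set w | e v w]).
have -> : [set w | e v w] :&: [set w | dist e u w == i] =
          [set w | e v w & dist e u w == i] by apply/setP=> w; rewrite !inE.
suff -> : [set w | e v w] :\: [set w | dist e u w == i] =
          [set w | e v w & (dist e u w).+1 == dist e u v] by rewrite addnK.
apply/setP=> w; rewrite !inE andbC; have [evw|//] := boolP (e v w).
have ndw : dist e u w != dist e u v.
  have ldv : dist e u v <= i by rewrite -d2.
  apply/negP=> dw; have /cards0_eq/setP/(_ w) := a0 _ v ldv erefl.
  by rewrite !inE evw dw.
have := dist_edge conn_e u evw; rewrite sym_e in evw.
have := dist_edge conn_e u evw; move: ndw d2; lia.
Qed.

End Cycles.

(** * Annihilation of a symmetric matrix by its eigenvalues *)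

Import Order.TTheory GRing.Theory Num.Theory.
Local Open Scope ring_scope.

Lemma symmetric_annihilated (R : rcfType) n (A : 'M[R]_n) (s : seq R) :
  A^T = A -> s =i eigenvalue A -> \prod_(x <- s) (A - x%:M) = 0.
Proof.
case: n A => [|n] A symA sE; first exact: flatmx0.
pose p := \prod_(x <- s) ('X - x%:P).
have -> : \prod_(x <- s) (A - x%:M) = horner_mx A p.
  rewrite rmorph_prod; apply: eq_bigr => x _.
  by rewrite rmorphB /= horner_mx_X horner_mx_C.
(* The matrix is diagonalized over the complex numbers; being hermitian it has real diagonal
   entries, which are therefore eigenvalues of [A] itself. *)
apply: (map_mx_inj (f := real_complex R)); rewrite map_mx0 map_horner_mx.
set B := map_mx _ A.
have realB : B \is a mxOver Num.real.
  by apply/mxOverP => i j; rewrite mxE complex_real.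
have hermB : B \is hermsymmx.
  apply: realsym_hermsym realB; apply/is_hermitianmxP.
  by rewrite expr0 scale1r map_mx_id // /B map_trmx symA.
have /orthomx_spectralP defB := hermitian_normalmx hermB.
have /mxOverP reald := hermitian_spectral_diag_real hermB.
have unitP := spectral_unit B.
set P := spectralmx B in defB unitP; set D := spectral_diag B in defB reald.
rewrite defB horner_mx_uconjC // horner_mx_diag.
suff -> : map_mx (horner (map_poly (real_complex R) p)) D = 0.
  by rewrite raddf0 mulmx0 mul0mx.
apply/rowP => i; rewrite !mxE.
have /complex_realP[y Dy] := reald 0 i.
rewrite Dy horner_map /=; apply/eqP; rewrite fmorph_eq0.
rewrite -/(root _ _) root_prod_XsubC sE.
suff: eigenvalue B y%:C%C by rewrite eigenvalue_map.
(* The rows of the change of basis [P] are eigenvectors, nonzero since [P] is invertible. *)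
apply/eigenvalueP; exists (row i P).
  rewrite -row_mul {1}defB !mulmxA mulmxV // mul1mx row_mul.
  by rewrite row_diag_mx -scalemxAl -rowE Dy.
apply: contraTneq unitP => Pi0; rewrite -row_free_unit -kermx_eq0.
apply/rowV0Pn; exists (delta_mx 0 i); first by apply/sub_kermxP; rewrite -rowE.
by apply/eqP=> /rowP/(_ i)/eqP; rewrite !mxE !eqxx oner_eq0.
Qed.

(** * Matrices indexed by vertices and distance-invariance *)

Section Matrices.
Variables (R : rcfType) (T : finType) (e : rel T).
Hypothesis sym_e : symmetric e.
Hypothesis conn_e : forall u v : T, connect e u v.
Local Notation mx := 'M[R]_#|T|.
Local Notation A := (adjacency e R).

(* [scalerAl] does not apply: for an unknown [#|T|] square matrices are not known
   to form an algebra. *)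
Lemma scale_mulAl a (M N : mx) : a *: (M * N) = a *: M * N.
Proof. exact: scalemxAl. Qed.

Lemma mul_linear_factor x (M : mx) : (A - x%:M) * M = A * M - x *: M.
Proof. by rewrite mulrBl; congr (_ - _); exact: mul_scalar_mx. Qed.

Definition entry (M : mx) (u v : T) : R := M (enum_rank u) (enum_rank v).

Definition graph_mx (F : T -> T -> R) : mx :=
  \matrix_(i, j) F (enum_val i) (enum_val j).

Lemma entry_graph_mx F u v : entry (graph_mx F) u v = F u v.
Proof. by rewrite /entry mxE !enum_rankK. Qed.

Lemma eq_entry M N : (forall u v, entry M u v = entry N u v) -> M = N.
Proof.
by move=> H; apply/matrixP=> i j; have := H (enum_val i) (enum_val j);
  rewrite /entry !enum_valK.
Qed.

Lemma entryD M N u v : entry (M + N) u v = entry M u v + entry N u v.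
Proof. by rewrite /entry mxE. Qed.

Lemma entryZ a M u v : entry (a *: M) u v = a * entry M u v.
Proof. by rewrite /entry mxE. Qed.

Lemma entry0 u v : entry 0 u v = 0.
Proof. by rewrite /entry mxE. Qed.

Lemma sum_neighbours v (F : T -> R) :
  \sum_(i < #|T|) F (enum_val i) * A i (enum_rank v) = \sum_(w | e v w) F w.
Proof.
rewrite (reindex _ (onW_bij _ (enum_rank_bij T))) /= [RHS]big_mkcond.
apply: eq_bigr => w _; rewrite mxE !enum_rankK sym_e.
by case: (e v w); rewrite ?mulr1 ?mulr0.
Qed.

Lemma entry_mulA M u v : entry (M * A) u v = \sum_(w | e v w) entry M u w.
Proof.
rewrite /entry mxE -sum_neighbours.
by apply: eq_bigr => i _; rewrite enum_valK.
Qed.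

Lemma adjacency_sym : A^T = A.
Proof. by apply/matrixP => i j; rewrite !mxE sym_e. Qed.

Lemma entry_Amul M u v : entry (A * M) u v = \sum_(w | e u w) entry M w v.
Proof.
rewrite /entry mxE -sum_neighbours; apply: eq_bigr => i _.
by rewrite enum_valK -{1}adjacency_sym mxE mulrC.
Qed.

Definition dist_inv (M : mx) : Prop := forall u v u' v' : T,
  dist e u v = dist e u' v' -> entry M u v = entry M u' v'.

Lemma dist_inv0 : dist_inv 0.
Proof. by move=> u v u' v' _; rewrite !entry0. Qed.

Lemma dist_invD M N : dist_inv M -> dist_inv N -> dist_inv (M + N).
Proof. by move=> hM hN u v u' v' d; rewrite !entryD (hM _ _ _ _ d) (hN _ _ _ _ d). Qed.

Lemma dist_invZ a M : dist_inv M -> dist_inv (a *: M).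
Proof. by move=> hM u v u' v' d; rewrite !entryZ (hM _ _ _ _ d). Qed.

Lemma dist_invB M N : dist_inv M -> dist_inv N -> dist_inv (M - N).
Proof. by move=> hM hN; rewrite -scaleN1r; apply/dist_invD/dist_invZ. Qed.

(** A predicate covers at once a single distance, the all-ones matrix ([predT]) and the pairs at
    distance of a given parity. *)
Definition dist_mx (f : pred nat) : mx := graph_mx (fun u v => (f (dist e u v))%:R).

Lemma entry_dist_mx f u v : entry (dist_mx f) u v = (f (dist e u v))%:R.
Proof. exact: entry_graph_mx. Qed.

Lemma dist_inv_dist_mx f : dist_inv (dist_mx f).
Proof. by move=> u v u' v' d; rewrite !entry_dist_mx d. Qed.

Local Notation D i := (dist_mx (pred1 i)).

Lemma dist_mx0 : D 0%N = 1.
Proof.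
apply: eq_entry => u v; rewrite entry_dist_mx /= dist_eq0 //.
by rewrite /entry mxE (inj_eq enum_rank_inj).
Qed.

Lemma entry_dist_mx_mulA i u v : entry (D i * A) u v = (a_num e i u v)%:R.
Proof.
rewrite entry_mulA /a_num -sum1_card natr_sum [RHS]big_mkcond [LHS]big_mkcond.
apply: eq_bigr => w _; rewrite inE entry_dist_mx /=.
by case: (e v w); case: (dist e u w == i).
Qed.

(** Apart from [c_num] at 0, which vanishes, [c_num] and [b_num] are [a_num] with the index shifted
    by one, so the products [D j * A] give all three numbers. *)
Lemma distance_regular_of_dist_inv : (0 < #|T|)%N ->
  (forall i, dist_inv (D i * A)) -> distance_regular e.
Proof.
move=> T0 H; split=> // i _.
have Ha j u v u' v' : dist e u v = dist e u' v' ->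
    a_num e j u v = a_num e j u' v'.
  by move=> /(H j) /eqP; rewrite !entry_dist_mx_mulA eqr_nat => /eqP.
have Hc u v u' v' : dist e u v = dist e u' v' ->
    c_num e i u v = c_num e i u' v'.
  case: i => [|j] d; last exact: (Ha j).
  by rewrite /c_num !eq_card0 // => w; rewrite !inE andbF.
have [/existsP[u /existsP[v /eqP duv]]|no] :=
    boolP [exists u, exists v, dist e u v == i].
  exists (c_num e i u v), (a_num e i u v), (b_num e i u v) => u' v' d.
  by split; [apply: Hc|apply: Ha|apply: (Ha i.+1)]; rewrite d duv.
exists 0%N, 0%N, 0%N => u v d; case/negP: no.
by apply/existsP; exists u; apply/existsP; exists v; rewrite d.
Qed.

(* From distance m on, f singles out i, so D i is dist_mx f minus some of the D j
   with j < m. *)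
Lemma dist_inv_peel m i (f : pred nat) :
    (forall j, (j < m)%N -> dist_inv (D j * A)) -> dist_inv (dist_mx f * A) ->
    (forall u v, f (dist e u v) && (m <= dist e u v)%N = (dist e u v == i)) ->
  dist_inv (D i * A).
Proof.
move=> Hm Hf Hi; pose g m' : pred nat := fun t => f t && (t < m')%N.
have Hg m' : (m' <= m)%N -> dist_inv (dist_mx (g m') * A).
  elim: m' => [_|m' IH lm].
    have -> : dist_mx (g 0%N) = 0.
      by apply: eq_entry => u v; rewrite entry_dist_mx entry0 /g andbF.
    by rewrite mul0r; exact: dist_inv0.
  have -> : dist_mx (g m'.+1) = dist_mx (g m') + (f m')%:R *: D m'.
    apply: eq_entry => u v; rewrite entryD entryZ !entry_dist_mx /= /g ltnS.
    case: ltngtP => [|_|->]; last by case: (f m'); rewrite ?mulr1 ?mulr0 ?add0r ?addr0.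
      by rewrite mulr0 addr0.
    by rewrite mulr0 addr0.
  rewrite mulrDl -scale_mulAl; apply: dist_invD; first exact/IH/ltnW.
  exact/dist_invZ/Hm.
have -> : D i = dist_mx f - dist_mx (g m).
  apply: eq_entry => u v; rewrite -scaleN1r entryD entryZ !entry_dist_mx /= -Hi /g.
  by case: (f _); case: leqP; rewrite /= ?mulr0 ?addr0 // mulr1 subrr.
by rewrite mulrBl; apply: dist_invB (Hg _ _).
Qed.

(** * Powers of the adjacency matrix *)

Lemma prod_comm (s : seq R) :
  A * \prod_(x <- s) (A - x%:M) = \prod_(x <- s) (A - x%:M) * A.
Proof.
apply: commr_prod => y _; apply: commrB; first exact: commr_refl.
exact: comm_mx_scalar.
Qed.

(** The product is monic in [A], so it differs from its leading power by lower powers. *)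
Lemma dist_inv_leading_power (s : seq R) :
    (forall j, (j < size s)%N -> dist_inv (A ^+ j)) ->
    dist_inv (\prod_(x <- s) (A - x%:M)) ->
  dist_inv (A ^+ size s).
Proof.
move=> Hs Hp; rewrite -[A ^+ _](subKr (\prod_(x <- s) (A - x%:M))).
(* The induction on [s] needs the lower-order part multiplied by any power [A ^+ j]; here
   [j = 0]. *)
apply: dist_invB => //; rewrite -[_ - _]mulr1 -[X in _ * X](expr0 A).
have {Hs Hp} : forall j, (j < size s)%N -> dist_inv (A ^+ (j + 0)).
  by move=> j; rewrite addn0; exact: Hs.
elim: s 0%N => [|x s IH] j Hs.
  by rewrite big_nil expr0 subrr mul0r; exact: dist_inv0.
rewrite big_cons /=; set p := \prod_(y <- s) _ in IH *.
have Hs' i : (i < size s)%N -> dist_inv (A ^+ (i + j)).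
  by move=> li; apply: Hs; rewrite ltnW.
have -> : ((A - x%:M) * p - A ^+ (size s).+1) * A ^+ j =
    (p - A ^+ size s) * A ^+ j.+1 - x *: ((p - A ^+ size s) * A ^+ j)
    - x *: A ^+ (size s + j).
  have cAp : A * p = p * A := prod_comm s.
  rewrite mul_linear_factor !mulrBl -scale_mulAl -!mulrA [A * (p * _)]mulrA cAp.
  rewrite -!mulrA -!exprS -!exprD.
  rewrite addnS addSn scalerBr.
  rewrite opprB -!addrA; congr (_ + _).
  by rewrite [X in _ = _ + X]addrCA subrr addr0 addrC.
apply: dist_invB; last by apply/dist_invZ/Hs.
apply: dist_invB; last exact/dist_invZ/IH.
by apply: IH => i li; rewrite addnS -addSn; apply: Hs.
Qed.

Section LocalRecurrence.
Variable m : nat.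
Hypothesis rec_D : forall i, (i.+1 < m)%N ->
  exists b : R, D i * A = D i.+1 + b *: D i.-1.

(** Each factor [A] raises the index by at most one, so the recurrence applies [j] times. *)
Lemma dist_inv_local_power j i : (i + j < m)%N -> dist_inv (D i * A ^+ j).
Proof.
elim: j i => [|j IH] i lm; first by rewrite expr0 mulr1; exact: dist_inv_dist_mx.
have [|b Eb] := rec_D (i := i); first by lia.
rewrite exprS mulrA Eb mulrDl -scale_mulAl.
by apply/dist_invD/dist_invZ; apply: IH; lia.
Qed.

(** The recurrence read backwards trades index for exponent, down to [D 0 = 1]. It preserves the
    bound [i + j <= m] on index plus exponent, so [A ^+ m] is the only power needed beyond the local
    ones. *)
Lemma dist_inv_dist_mx_mulA : dist_inv (A ^+ m) ->
  forall i, (i < m)%N -> dist_inv (D i * A).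
Proof.
move=> HA i lim; rewrite -[X in _ * X]expr1.
have : (i + 1 <= m)%N by rewrite addn1.
elim/ltn_ind: i 1%N {lim} => -[|i] IH j lm.
  rewrite dist_mx0 mul1r; move: lm; rewrite add0n leq_eqVlt => /predU1P[->//|lm].
  by rewrite -[A ^+ j]mul1r -dist_mx0; apply: dist_inv_local_power.
have [lt1|] := ltnP i.+1 m; last first.
  move=> lmi; have -> : j = 0%N by lia.
  by rewrite expr0 mulr1; exact: dist_inv_dist_mx.
have [b Eb] := rec_D lt1.
have -> : D i.+1 * A ^+ j = D i * A ^+ j.+1 - b *: (D i.-1 * A ^+ j).
  by rewrite exprS mulrA Eb mulrDl scale_mulAl addrK.
apply: dist_invB; first by apply: IH; lia.
by apply: dist_invZ; apply: IH; lia.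
Qed.

End LocalRecurrence.

(** A factor [A - x] links only vertices at distance at most one. *)
Lemma entry_prod_far (s : seq R) u v : (size s < dist e u v)%N ->
  entry (\prod_(x <- s) (A - x%:M)) u v = 0.
Proof.
elim: s u => [|x s IH] u /= luv.
  by rewrite big_nil -dist_mx0 entry_dist_mx /= gtn_eqF.
rewrite big_cons mul_linear_factor -scaleNr entryD entryZ.
rewrite entry_Amul IH ?mulr0 ?addr0; last exact: ltnW.
apply: big1 => w euw; apply: IH.
have := dist_edge conn_e v (v := w) (w := u); rewrite sym_e euw => /(_ isT).
by rewrite !(distC sym_e conn_e v); lia.
Qed.

(** * Regularity and eigenvectors for the degree *)

Variable k : nat.
Hypothesis reg_e : forall v : T, #|[set w | e v w]| = k.

Lemma sum_neighbours_const v (a : R) : \sum_(w | e v w) a = k%:R * a.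
Proof.
rewrite big_const iter_addr_0 mulr_natl -(reg_e v); congr (_ *+ _).
by apply: eq_card => w; rewrite !inE.
Qed.

(* Maximum principle: a maximum spreads to the neighbours. *)
Lemma harmonic_const (x : T -> R) :
    (forall v, \sum_(w | e v w) x w = k%:R * x v) ->
  forall u v, x u = x v.
Proof.
move=> Hx u0 v0.
case: (@arg_maxP _ _ _ u0 predT x isT) => z _ zmax.
suff H v : x v = x z by rewrite !H.
case/connectP: (conn_e z v) => p ep ->{v}.
elim/last_ind: p ep => [//|p v IH]; rewrite rcons_path last_rcons => /andP[ep ev].
have xl := IH ep.
have : \sum_(w | e (last z p) w) (x z - x w) = 0.
  by rewrite big_split /= sumrN Hx sum_neighbours_const xl subrr.
move=> /psumr_eq0P H; apply/esym/eqP; rewrite -subr_eq0; apply/eqP/H => // w _.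
by rewrite subr_ge0; exact: zmax.
Qed.

Lemma entry_const (M : mx) : M * A = k%:R *: M -> A * M = k%:R *: M ->
  forall u v u' v', entry M u v = entry M u' v'.
Proof.
move=> H1 H2 u v u' v'; transitivity (entry M u v').
  by apply: (@harmonic_const (entry M u)) => w; rewrite -entry_mulA H1 entryZ.
apply: (@harmonic_const (fun w => entry M w v')) => w.
by rewrite -entry_Amul H2 entryZ.
Qed.

Lemma all_ones_mulA : dist_mx predT * A = k%:R *: dist_mx predT.
Proof.
apply: eq_entry => u v; rewrite entryZ entry_mulA.
under eq_bigr => w _ do rewrite entry_dist_mx.
by rewrite sum_neighbours_const entry_dist_mx.
Qed.

Lemma prod_entry_const (s : seq R) : k%:R :: s =i eigenvalue A ->
  forall u v u' v', entry (\prod_(x <- s) (A - x%:M)) u v =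
                    entry (\prod_(x <- s) (A - x%:M)) u' v'.
Proof.
move=> /(symmetric_annihilated adjacency_sym).
rewrite big_cons mul_linear_factor => /eqP.
rewrite subr_eq0 => /eqP E; apply: entry_const => //.
by rewrite -prod_comm.
Qed.

(** A pair farther apart would make one entry of the product 0, hence all of them, as they are
    equal. But the product multiplies the all-ones matrix by the product of the [k - x], which is
    nonzero. *)
Lemma dist_le_spectrum (s : seq R) :
    k%:R :: s =i eigenvalue A -> k%:R \notin s ->
  forall u v, (dist e u v <= size s)%N.
Proof.
move=> sE ks u v; rewrite leqNgt; apply/negP => far.
have q0 : \prod_(x <- s) (A - x%:M) = 0.
  apply: eq_entry => u' v'; rewrite (prod_entry_const sE u' v' u v) entry0.
  exact: entry_prod_far.
have : dist_mx predT * \prod_(x <- s) (A - x%:M) =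
    (\prod_(x <- s) (k%:R - x)) *: dist_mx predT.
  elim: s {sE ks far q0} => [|x s IH]; first by rewrite !big_nil mulr1 scale1r.
  rewrite !big_cons mulrA mulrBr all_ones_mulA [_ * x%:M]mul_mx_scalar -scalerBl.
  by rewrite -scale_mulAl IH scalerA.
rewrite q0 mulr0 => /(congr1 (fun M => entry M u v)) /esym /eqP.
rewrite entry0 entryZ entry_dist_mx mulr1 prodf_seq_eq0 => /hasP[x xs /=].
by rewrite subr_eq0 => /eqP kx; rewrite kx xs in ks.
Qed.

Lemma degree_eigenvalue : (0 < #|T|)%N -> eigenvalue A k%:R.
Proof.
move=> T0; apply/eigenvalueP; exists (const_mx 1).
  apply/rowP => j; rewrite !mxE -[j]enum_valK.
  under eq_bigr => i _ do rewrite mxE.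
  by rewrite (sum_neighbours _ (fun=> 1)) sum_neighbours_const.
by apply/eqP => /rowP/(_ (Ordinal T0))/eqP; rewrite !mxE oner_eq0.
Qed.

(** * Bipartite graphs and the eigenvalue [-k] *)

Section Bipartite.
Variable side : T -> bool.
Hypothesis side_e : forall u v, e u v -> side u != side v.
Local Notation sg v := ((-1) ^+ side v : R).

Lemma odd_dist u v : odd (dist e u v) = side u (+) side v.
Proof.
have [p [ep <- <-]] := dist_path conn_e u v.
elim: p u ep {v} => [|w p IH] u /=; first by rewrite addbb.
by move=> /andP[/side_e + /IH ->]; case: (side u); case: (side w); case: (side _).
Qed.

Lemma sg_edge u v : e u v -> sg v = - sg u.
Proof.
by move=> /side_e; case: (side u); case: (side v); rewrite // ?expr1 ?expr0 ?opprK.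
Qed.

Lemma opp_degree_eigenvalue : (0 < #|T|)%N -> eigenvalue A (- k%:R).
Proof.
move=> T0; apply/eigenvalueP; exists (\row_i sg (enum_val i)).
  apply/rowP => j; rewrite !mxE -[j]enum_valK.
  under eq_bigr => i _ do rewrite mxE.
  rewrite (sum_neighbours _ (fun v => sg v)) enum_valK mulNr -mulrN.
  rewrite -(sum_neighbours_const (enum_val j)); apply: eq_bigr => w; exact: sg_edge.
apply/eqP => /rowP/(_ (Ordinal T0))/eqP; rewrite !mxE.
by rewrite signr_eq0.
Qed.

(* Multiplying by the sign of the side turns -k-eigenvectors into
   k-eigenvectors. *)
Lemma antiharmonic (x : T -> R) :
    (forall v, \sum_(w | e v w) x w = - k%:R * x v) ->
  forall u v, sg u * x u = sg v * x v.
Proof.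
move=> Hx; apply: harmonic_const => v; rewrite mulrCA -[k%:R * _]opprK -mulNr -Hx.
by rewrite mulrN -mulNr big_distrr /=; apply: eq_bigr => w /sg_edge ->.
Qed.

(** Rows and columns are multiples of the sign vector, so the entries are a constant times
    [sg u * sg v], which depends only on the parity of the distance. *)
Lemma dist_inv_anti (M : mx) : M * A = - k%:R *: M -> A * M = - k%:R *: M ->
  dist_inv M.
Proof.
move=> H1 H2 u v u' v' /(congr1 odd); rewrite !odd_dist => par.
have E1 : sg v * entry M u v = sg v' * entry M u v'.
  by apply: (@antiharmonic (entry M u)) => w; rewrite -entry_mulA H1 entryZ.
have E2 : sg u * entry M u v' = sg u' * entry M u' v'.
  apply: (@antiharmonic (fun w => entry M w v')) => w.
  by rewrite -entry_Amul H2 entryZ.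
have par' : sg u * sg v = sg u' * sg v' by rewrite -!signr_addb par.
apply: (@mulfI _ (sg u * sg v)); first by rewrite mulf_neq0 ?signr_eq0.
by rewrite [in RHS]par' -!mulrA E1 mulrCA E2 mulrCA.
Qed.

Lemma dist_inv_parity_mulA b : dist_inv (dist_mx (fun t => odd t == b) * A).
Proof.
have -> : dist_mx (fun t => odd t == b) * A =
    k%:R *: dist_mx (fun t => odd t == ~~ b).
  apply: eq_entry => u v; rewrite entryZ entry_mulA entry_dist_mx.
  rewrite -(sum_neighbours_const v); apply: eq_bigr => w /side_e.
  rewrite entry_dist_mx !odd_dist.
  by case: (side u); case: (side v); case: (side w); case: b.
exact/dist_invZ/dist_inv_dist_mx.
Qed.

(** With [q] the product, [A q + k q] has constant entries and [A q - k q] has [-k]-eigenvectors as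
    rows and columns; their difference is [2k q]. *)
Lemma dist_inv_prod_bipartite (s : seq R) : k != 0%N ->
    k%:R :: - k%:R :: s =i eigenvalue A ->
  dist_inv (\prod_(x <- s) (A - x%:M)).
Proof.
move=> k0 sE; have sE' : - k%:R :: k%:R :: s =i eigenvalue A.
  by move=> x; rewrite -sE !inE orbCA.
set q := \prod_(x <- s) _.
have Hy : dist_inv (A * q + k%:R *: q).
  move=> u v u' v' _; have := prod_entry_const sE u v u' v'.
  by rewrite big_cons mul_linear_factor scaleNr opprK.
have Hz : dist_inv (A * q - k%:R *: q).
  have := symmetric_annihilated adjacency_sym sE'.
  rewrite big_cons mul_linear_factor.
  set z := \prod_(x <- _) _ => /eqP; rewrite subr_eq0 => /eqP E.
  have -> : A * q - k%:R *: q = z.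
    by rewrite /z big_cons mul_linear_factor.
  by apply: dist_inv_anti => //; rewrite -prod_comm.
have -> : q = (k%:R *+ 2)^-1 *: (A * q + k%:R *: q - (A * q - k%:R *: q)).
  rewrite opprB addrC addrA subrK -scalerDl scalerA -mulr2n mulVf ?scale1r //.
  by rewrite -mulrnA pnatr_eq0 muln_eq0 negb_or k0.
exact/dist_invZ/dist_invB.
Qed.

End Bipartite.

(** * From large girth to distance-regularity *)

Lemma local_recurrence m : irreflexive e ->
    (forall c i, graph_cycle e c -> (i.+1 < m)%N -> (i.+1.*2 < size c)%N) ->
  forall i, (i.+1 < m)%N -> exists b : R, D i * A = D i.+1 + b *: D i.-1.
Proof.
(* The coefficient is the number of neighbours going outward from distance [i-1]: [k] for [i = 1],
   then [k-1]. It is 0 for [i = 0], where [i.-1] is truncated. *)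
move=> irr_e girth i lim; exists ((0 < i) * (k - (0 < i.-1)))%:R.
apply: eq_entry => u v; rewrite entryD entryZ entry_dist_mx_mulA !entry_dist_mx.
rewrite (@a_num_large_girth _ e sym_e irr_e conn_e k reg_e) => [|c cc]; last exact: girth.
rewrite natrD -natrM /=; congr (_ + _%:R).
case: i {lim} => [|i] /=; first by rewrite mul0n.
by rewrite eqSS mul1n mulnC; case: eqP => [->|]; rewrite ?muln0.
Qed.

Lemma dist_mx_empty i : (forall u v, dist e u v < i)%N -> D i = 0.
Proof. by move=> H; apply: eq_entry => u v; rewrite entry_dist_mx entry0 /= ltn_eqF. Qed.

Lemma distance_regular_girth d (s : seq R) : (0 < #|T|)%N ->
    k%:R :: s =i eigenvalue A -> k%:R \notin s -> size s = d ->
    (forall i, (i.+1 < d)%N -> exists b : R, D i * A = D i.+1 + b *: D i.-1) ->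
  distance_regular e.
Proof.
move=> T0 sE ks sd rec_D; apply: distance_regular_of_dist_inv => // i.
have diam u v : (dist e u v <= d)%N by rewrite -sd dist_le_spectrum.
have DAd : dist_inv (A ^+ d).
  rewrite -sd; apply: dist_inv_leading_power => [j|u v u' v' _].
    rewrite -[A ^+ j]mul1r -dist_mx0 sd => ljd.
    exact: (dist_inv_local_power rec_D).
  exact: prod_entry_const.
have Dlt := dist_inv_dist_mx_mulA rec_D DAd.
have [lid|ldi|->] := ltngtP i d; first exact: Dlt.
  rewrite dist_mx_empty ?mul0r; first exact: dist_inv0.
  by move=> u v; apply: leq_ltn_trans ldi.
apply: (dist_inv_peel (f := predT) Dlt) => [|u v].
  by rewrite all_ones_mulA; apply/dist_invZ/dist_inv_dist_mx.
by rewrite eqn_leq diam.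
Qed.

(** Here [s] omits both [k] and [-k], so [d] is two less than the number of eigenvalues and the
    diameter is at most [d+1]. *)
Lemma distance_regular_bipartite_girth d (s : seq R) (side : T -> bool) :
    (0 < #|T|)%N -> (forall u v, e u v -> side u != side v) ->
    k != 0%N -> uniq [:: k%:R, - k%:R & s] ->
    [:: k%:R, - k%:R & s] =i eigenvalue A -> size s = d ->
    (forall i, (i.+1 < d)%N -> exists b : R, D i * A = D i.+1 + b *: D i.-1) ->
  distance_regular e.
Proof.
move=> T0 side_e k0 us sE sd rec_D; apply: distance_regular_of_dist_inv => // i.
have diam u v : (dist e u v <= d.+1)%N.
  by rewrite -sd; apply: (dist_le_spectrum sE); case/andP: us.
have DAd : dist_inv (A ^+ d).
  rewrite -sd; apply: dist_inv_leading_power => [j|].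
    rewrite -[A ^+ j]mul1r -dist_mx0 sd => ljd.
    exact: (dist_inv_local_power rec_D).
  exact: (dist_inv_prod_bipartite side_e).
have Dlt := dist_inv_dist_mx_mulA rec_D DAd.
have [lid|ldi] := ltnP i d; first exact: Dlt.
have [ldi'|lid] := ltnP d.+1 i.
  rewrite dist_mx_empty ?mul0r; first exact: dist_inv0.
  by move=> u v; apply: leq_ltn_trans ldi'.
(* Only [i = d] and [i = d+1] are left, and their parities differ. *)
apply: (dist_inv_peel Dlt (dist_inv_parity_mulA side_e (odd i))) => u v.
by have := diam u v; lia.
Qed.

End Matrices.

(* For d = 0 the truncated differences are 0, which loses nothing since a girth
   is nonnegative; the same holds for 2 * d - 2 when d = 1. *)
Theorem theorem4p4 (R : rcfType) (T : finType) (e : rel T)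
    (g : option nat) (d : nat)
    (simple_e : simple_graph e) (conn_e : connected_graph e)
    (reg_e : regular_graph e) (girth_e : is_girth e g)
    (spec_e : num_eigenvalues (adjacency e R) d.+1)
    (large_girth : girth_ge g (2 * d - 1) \/
                   (girth_ge g (2 * d - 2) /\ bipartite e)) :
  distance_regular e.
Proof.
have [sym_e irr_e] := simple_e; have [T0 conn] := conn_e.
have [k reg] := reg_e; have [s [us ss sE]] := spec_e.
have ks : k%:R \in s by rewrite sE; apply: degree_eigenvalue.
have girth t c : girth_ge g t -> graph_cycle e c -> (t <= size c)%N.
  case: g girth_e {large_girth} => [m [_ H] lt cc|H _ /H//].
  exact: leq_trans lt (H c cc).
have perm1 := perm_to_rem ks.
have us1 : uniq (k%:R :: rem k%:R s) by rewrite -(perm_uniq perm1).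
have sE1 : k%:R :: rem k%:R s =i eigenvalue (adjacency e R).
  by move=> x; rewrite -sE (perm_mem perm1).
have sz1 : size (rem k%:R s) = d by rewrite size_rem // ss.
have case1 : (forall c, graph_cycle e c -> 2 * d - 1 <= size c)%N ->
    distance_regular e.
  move=> Hc; apply: (distance_regular_girth sym_e conn reg T0 sE1 _ sz1).
    by case/andP: us1.
  (* From [i+1 < d] follows [2(i+1) <= 2d-2], just below the girth bound. *)
  by apply: (local_recurrence _ sym_e conn reg irr_e) => c i /Hc; lia.
case: large_girth => [lg|[lg [side side_e]]].
  by apply: case1 => c; apply: girth.
(* For [d <= 2] the first case applies, as every cycle has length at least [3 >= 2d-1]. *)
have [d2|d3] := leqP d 2; first by apply: case1 => c [_]; lia.
(* For [k = 0] the adjacency matrix would be 0, with at most one eigenvalue. *)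
have k0 : k != 0%N.
  apply/eqP => k0.
  have A0 : adjacency e R = 0.
    apply/matrixP => i j; rewrite !mxE; case: (boolP (e _ _)) => // eij.
    have := cards0_eq (etrans (reg (enum_val i)) k0) => /setP/(_ (enum_val j)).
    by rewrite !inE eij.
  have : (size s <= size [:: (0%R : R)])%N.
    apply: uniq_leq_size => // x; rewrite sE inE => /eigenvalueP[v].
    rewrite A0 mulmx0 => /esym/eqP; rewrite scaler_eq0.
    by case/orP=> [//|/eqP->]; rewrite eqxx.
  by rewrite ss /=; lia.
have nks : - k%:R \in rem k%:R s.
  have : - k%:R \in k%:R :: rem k%:R s.
    by rewrite sE1; apply: (opp_degree_eigenvalue _ sym_e reg side_e).
  rewrite inE => /predU1P[/eqP|//].
  by rewrite eq_sym -addr_eq0 -mulr2n -mulrnA pnatr_eq0 muln_eq0 (negPf k0).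
have perm2 := perm_to_rem nks.
have perm12 : perm_eq (k%:R :: rem k%:R s) [:: k%:R, - k%:R & rem (- k%:R) (rem k%:R s)].
  by rewrite perm_cons.
(* With [k] and [-k] removed, [d-1] eigenvalues remain; the recurrence is then needed only on a
   shorter range, which a smaller girth allows. *)
apply: (distance_regular_bipartite_girth (s := rem (- k%:R) (rem k%:R s)) (d := d.-1)
          sym_e conn reg T0 side_e k0).
- by rewrite -(perm_uniq perm12) us1.
- by move=> x; rewrite -(perm_mem perm12) sE1.
- by rewrite size_rem // sz1.
- by apply: (local_recurrence _ sym_e conn reg irr_e) => c i /(girth _ _ lg); lia.
Qed.
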